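(* If a $\mathrm{DF}(V,K,\Lambda)$ with $K\ge2$ exists, then an $\mathrm{ECTFF}\bigl(\tfrac{\Lambda(V-1)}{K-1},\,V,\,\tfrac{\Lambda(V-1)}{K(K-1)}\bigr)$ exists. In particular, for any prime power $Q$ and positive integers $K$ and $R$ such that $K\le Q$, an $\mathrm{ECTFF}(KR,Q,R)$ exists whenever both $\frac{RK(K-1)}{Q-1}\in\mathbb Z$ and any one of the following three additional conditions is met: (i) either $\frac{2RK}{Q-1}\in\mathbb Z$ or $\frac{2R(K-1)}{Q-1}\in\mathbb Z$; (ii) $R\ge Q-1$; (iii) $Q>[\frac12K(K-1)]^{K(K-1)}$.
   Context: Difference families: let $\mathcal V$ be a finite abelian group of order $V$ (written additively). A nonempty finite sequence $\{\mathcal D_r\}_{r\in\mathcal R}$ of subsets of $\mathcal V$, each of cardinality $K$, is a $\mathrm{DF}(V,K,\Lambda)$ for $\mathcal V$ if $\sum_{r\in\mathcal R}\#\{(d_1,d_2)\in\mathcal D_r\times\mathcal D_r:d_1-d_2=v\}=\Lambda$ for all $v\in\mathcal V$, $v\ne0$. When $K\ge2$ the number of subsets is then necessarily $\#(\mathcal R)=\frac{\Lambda(V-1)}{K(K-1)}$. Equichordal tight fusion frames: an $\mathrm{ECTFF}(D,N,R)$ is a sequence $\{\mathcal U_n\}_{n=1}^N$ of $N>1$ subspaces, each of dimension $R\geq 1$, of a $D$-dimensional complex Hilbert space, whose orthogonal projections $\mathbf P_n$ satisfy $\sum_{n=1}^N\mathbf P_n=A\mathbf I$ for some $A>0$ and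 for which $\operatorname{Tr}(\mathbf P_{n_1}\mathbf P_{n_2})$ is constant over all $n_1\neq n_2$. *)

(* Defs.v *)
From mathcomp Require Import all_boot all_order all_algebra.
From mathcomp Require Import reals complex.

Set Implicit Arguments.
Unset Strict Implicit.
Unset Printing Implicit Defensive.

Import Order.TTheory GRing.Theory Num.Theory.
Local Open Scope ring_scope.

Definition is_difference_family (G : finZmodType) (K L : nat)
    (DD : seq {set G}) : Prop :=
  [/\ DD != [::],
      forall B, B \in DD -> #|B| = K
    & forall v : G, v != 0 ->
        (\sum_(B <- DD) #|[set d in setX B B | (d.1 - d.2)%R == v]|)%N = L].

Definition difference_family_exists (V K L : nat) : Prop :=
  exists (G : finZmodType) (DD : seq {set G}),
    #|G| = V /\ is_difference_family K L DD.

(* The Hilbert space is C^D, realised as row vectors with their standard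
   Hermitian inner product; [U n] stands for the subspace spanned by its rows,
   and [proj_ortho (U n)] is the matrix, acting on row vectors from the right,
   of the orthogonal projection onto that subspace.  In a numClosedFieldType,
   [0 < A] entails that A is real. *)
Definition is_ectff (C : numClosedFieldType) (D N R : nat)
    (U : 'I_N -> 'M[C]_D) : Prop :=
  [/\ (1 < N)%N,
      (0 < R)%N,
      forall n, \rank (U n) = R,
      exists2 A : C, 0 < A & \sum_(n < N) proj_ortho (U n) = A%:M
    & exists c : C, forall n1 n2 : 'I_N, n1 != n2 ->
        \tr (proj_ortho (U n1) *m proj_ortho (U n2)) = c].

Definition ectff_exists (C : numClosedFieldType) (D N R : nat) : Prop :=
  exists U : 'I_N -> 'M[C]_D, is_ectff R U.

Definition prime_power (Q : nat) : Prop :=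
  exists p m : nat, [/\ prime p, (0 < m)%N & Q = (p ^ m)%N].

(* Main.v *)
Require Import Defs.
From mathcomp Require Import all_boot all_order all_algebra.
From mathcomp Require Import all_fingroup all_solvable all_field mxrepresentation.
From mathcomp Require Import reals complex.
From mathcomp Require Import zify ring lra.

(* Index the coordinates of the Hilbert space by the pairs (r, d) with d in the
   r-th block. A character chi of the group gives, in each block, a flat vector
   (chi d)_d, and these span the subspace U_chi. Orthogonality of characters
   makes the U_chi a tight fusion frame, and Tr(P_chi P_psi) is a sum of
   chi psi^-1 over the block differences, hence depends only on K, R and Lambda.

   Over the field with Q elements, one takes the images of a single block B
   under a cyclic group of multipliers.
   (i), (ii): let h be h1 = gcd(K, Q-1), resp. h2 = gcd(K-1, Q-1), and let B,
   resp. B without 0, be a union of cosets of the multiplicative subgroup of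
   order h. Then (Q-1)/h blocks suffice, and half as many when Q and h are odd.
   As h1 and h2 are coprime, every admissible R >= Q-1 is a nonnegative
   combination of (Q-1)/h1 and (Q-1)/h2.
   (iii): with m dividing K(K-1)/2, B = {b_0, b_1, ...} is chosen so that the
   differences b_j - b_i (i < j) are equidistributed over the cosets of the
   subgroup of index m. The b_j are picked greedily; a second-moment count over
   all cosets shows that, for a set X, few x have far less than #X/m elements
   of X in x + (given coset). *)

Set Implicit Arguments.
Unset Strict Implicit.
Unset Printing Implicit Defensive.

Import Order.TTheory GRing.Theory Num.Theory.
Local Open Scope ring_scope.
Local Open Scope sesquilinear_scope.

(** * Characters of a finite abelian group *)

Lemma unimodular_unity_root (C : numClosedFieldType) (x : C) n :
  (0 < n)%N -> x ^+ n = 1 -> x^* = x^-1.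
Proof.
move=> n_gt0 xn1; have x1: `|x| = 1.
  apply/eqP; rewrite -(@pexpr_eq1 _ `|x| n) //; by rewrite -normrX xn1 normr1.
have x0 : x != 0 by rewrite -normr_eq0 x1 oner_eq0.
by apply: (mulfI x0); rewrite -normCK x1 expr1n divff.
Qed.

(** The group is abelian and [C] algebraically closed, so every irreducible representation has
    degree 1 and is given by its scalars [irr_mode]. The sums over characters are traces of the
    regular representation; the sums over the group follow because a left inverse of a square matrix
    is also a right inverse. *)
Lemma finZmod_characters (C : numClosedFieldType) (G : finZmodType) :
  exists X : 'I_#|G| -> G -> C,
  [/\ forall i, {morph X i : a b / a - b >-> a * b^*},
      forall a, a != 0 -> \sum_i X i a = 0,
      forall i a, `|X i a| = 1
    & forall i j, i != j -> \sum_a X i a * (X j a)^* = 0].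
Proof.
pose H := [set: G]%G.
have abH : abelian H.
  by apply/centsP => x _ y _; rewrite /commute; apply: addrC.
have splitH : group_splitting_field C H := @group_closure_closed_field C G H.
have charH : ([pchar C]^'.-group H)%g.
  by apply/pgroupP => p _ _; rewrite /= inE pchar_num.
have sH : irrType C H := DecSocleType _.
have centH : 'Z(H)%g = H by apply/center_idP.
have deg1 (i : sH) : irr_degree i = 1%N := irr_degree_abelian splitH abH i.
have cardH : #|sH| = #|G|.
  rewrite -[RHS]cardsT -(sum_irr_degree_pchar sH charH splitH) -sum1_card.
  by apply: eq_bigr => i _; rewrite deg1.
have inZ (a : G) : a \in 'Z(H)%g by rewrite centH inE.
pose X (i : 'I_#|G|) (a : G) : C := irr_mode (enum_val (cast_ord (esym cardH) i)) a.
have XD i a b : X i (a + b) = X i a * X i b.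
  exact: (irr_modeM splitH _ (inZ a) (inZ b)).
have X0 i : X i 0 = 1 by exact: irr_mode1.
have Xunity i a : X i a ^+ #|G| = 1.
  rewrite /X; set k := enum_val _.
  rewrite -(irr_modeX splitH) // -(irr_mode1 k); congr irr_mode.
  by have := expg_cardG (in_setT a); rewrite cardsT.
have cardG_gt0 : (0 < #|G|)%N by apply/card_gt0P; exists 0.
have Xconj i a : (X i a)^* = (X i a)^-1.
  exact: unimodular_unity_root cardG_gt0 (Xunity i a).
have Xneq0 i a : X i a != 0.
  apply/eqP => Xa0; have := Xunity i a.
  by rewrite Xa0 expr0n eqn0Ngt cardG_gt0 => /eqP; rewrite eq_sym oner_eq0.
have XB i a b : X i (a - b) = X i a * (X i b)^*.
  by apply: (mulIf (Xneq0 i b)); rewrite -XD subrK Xconj mulfVK.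
have col0 a : a != 0 -> \sum_i X i a = 0.
  move=> a0; transitivity (\tr (regular_repr C H a)); last first.
    rewrite [\tr _]big1 // => i _; rewrite 2!mxE /=.
    rewrite -(inj_eq enum_val_inj) gring_indexK ?inE //.
    by rewrite eq_mulVg1 mulKg; apply/eqP; rewrite pnatr_eq0 eqb0.
  rewrite (mxtrace_regular_pchar sH charH splitH) ?inE //.
  rewrite (reindex (fun i => enum_val (cast_ord (esym cardH) i))) /=; last first.
    exists (fun j => cast_ord cardH (enum_rank j)) => j _.
      by rewrite enum_valK cast_ordKV.
    by rewrite cast_ordK enum_rankK.
  apply: eq_bigr => i _; rewrite deg1 -/(irr_repr _) irr_center_scalar //.
  by rewrite mxtrace_scalar -irr_degreeE deg1.
exists X; split=> //.
  move=> i a; apply/eqP.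
  by rewrite -(@pexpr_eq1 _ `|X i a| #|G|) // -normrX Xunity normr1.
pose M := \matrix_(i < #|G|, j < #|G|) X i (enum_val j).
pose M' := \matrix_(j < #|G|, i < #|G|) ((#|G|%:R)^-1 * (X i (enum_val j))^* ).
have G0 : #|G|%:R != 0 :> C by rewrite pnatr_eq0 -lt0n.
have M'M : M' *m M = 1%:M.
  apply/matrixP=> j j'; rewrite !mxE.
  transitivity ((#|G|%:R)^-1 * \sum_i X i (enum_val j' - enum_val j)).
    rewrite mulr_sumr; apply: eq_bigr => i _.
    by rewrite !mxE XB -mulrA; congr (_ * _); rewrite mulrC.
  have [->|jj'] := eqVneq j j'.
    by rewrite subrr (eq_bigr _ (fun i _ => X0 i)) sumr_const card_ord mulVf.
  by rewrite col0 ?mulr0 // subr_eq0 (inj_eq enum_val_inj) eq_sym.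
move=> i j ij; have /matrixP/(_ i j) := mulmx1C M'M.
rewrite !mxE (negbTE ij) => /(congr1 ( *%R #|G|%:R)).
rewrite mulr0 mulr_sumr => s0; rewrite -[RHS]s0 big_enum_val /=.
by apply: eq_bigr => k _; rewrite !mxE mulrCA mulVKf.
Qed.

(** * Fusion frames from difference families *)

(** Write 1 = (1 - M) + M: the projection fixes the rows of [M] and kills those of [1 - M], which
    are orthogonal to them. *)
Lemma proj_ortho_hermitian_idem (C : numClosedFieldType) n (M : 'M[C]_n) :
  M *m M = M -> M^t* = M -> proj_ortho M = M.
Proof.
move=> MM Mt; rewrite -[LHS]mul1mx -[1%:M](subrK M) mulmxDl.
rewrite (proj_ortho_id (submx_refl M)) [X in X + _]proj_ortho_0 ?add0r //.
by apply/orthomx1P; rewrite Mt mulmxBl mul1mx MM subrr.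
Qed.

Lemma proj_ortho_of_coisometry (C : numClosedFieldType) m n (W : 'M[C]_(m, n)) (k : C) :
  0 < k -> W *m W^t* = k%:M ->
  let M := k^-1 *: (W^t* *m W) in proj_ortho M = M /\ \rank M = m.
Proof.
move=> k0 WW M; have kN0 : k != 0 by rewrite gt_eqF.
have WM : W *m M = W.
  by rewrite -scalemxAr mulmxA WW mul_scalar_mx scalerA mulVf ?scale1r.
split.
  apply: proj_ortho_hermitian_idem.
    by rewrite -[in LHS]scalemxAl -mulmxA WM.
  apply/matrixP => i j; rewrite !mxE rmorphM rmorph_sum /=.
  have -> : (k^-1)^* = k^-1 by apply/CrealP; rewrite realV gtr0_real.
  congr (_ * _); apply: eq_bigr => l _.
  by rewrite !mxE rmorphM /= conjCK mulrC.
apply/eqP; rewrite eqn_leq; apply/andP; split.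
  by rewrite /M scalemxAl (leq_trans (mxrankM_maxr _ _)) ?rank_leq_row.
rewrite (leq_trans _ (mxrankM_maxr W M)) // WM.
by rewrite -{1}(mxrank1 C m) -(mxrank_scale_nz _ kN0) scalemx1 -WW mxrankM_maxl.
Qed.

Section Construction.
Variables (C : numClosedFieldType) (G : finZmodType) (X : 'I_#|G| -> G -> C).
Hypothesis XB : forall i, {morph X i : a b / a - b >-> a * b^*}.
Hypothesis X_col : forall a, a != 0 -> \sum_i X i a = 0.
Hypothesis X_norm : forall i a, `|X i a| = 1.
Hypothesis X_row : forall i j, i != j -> \sum_a X i a * (X j a)^* = 0.
Variables (K L : nat) (DD : seq {set G}).
Hypothesis DD_DF : is_difference_family K L DD.

Let R := size DD.
Let B (r : 'I_R) := nth set0 DD r.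
Let S := [set p : 'I_R * G | p.2 \in B p.1].

Lemma card_block r : #|B r| = K.
Proof. by case: DD_DF => _ + _; apply; rewrite mem_nth. Qed.

Lemma sum_incidence (F : 'I_R -> G -> C) :
  \sum_(i < #|S|) F (enum_val i).1 (enum_val i).2 = \sum_r \sum_(d in B r) F r d.
Proof.
transitivity (\sum_(p in S) F p.1 p.2); first by rewrite [RHS]big_enum_val.
rewrite pair_big_dep /=.
by apply: eq_bigl => p; rewrite inE.
Qed.

Lemma card_incidence : #|S| = (K * R)%N.
Proof.
have := sum_incidence (fun _ _ => 1); rewrite sumr_const card_ord => /eqP.
rewrite (eq_bigr (fun _ => K%:R)) => [|r _]; last by rewrite sumr_const card_block.
by rewrite sumr_const card_ord -mulrnA eqr_nat => /eqP.
Qed.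

Let W n : 'M[C]_(R, #|S|) :=
  \matrix_(r, p) (((enum_val p).1 == r)%:R * (X n (enum_val p).2)^*).

(** Rows attached to different blocks have disjoint supports, so even the Gram matrices between
    different subspaces are diagonal. *)
Lemma frame_gram n1 n2 (r1 r2 : 'I_R) : (W n1 *m (W n2)^t*) r1 r2 =
  (r1 == r2)%:R * \sum_(d in B r1) (X n1 d)^* * X n2 d.
Proof.
rewrite !mxE; pose F (r : 'I_R) d := (r == r1)%:R * (r == r2)%:R * ((X n1 d)^* * X n2 d).
transitivity (\sum_(i < #|S|) F (enum_val i).1 (enum_val i).2).
  by apply: eq_bigr => i _; rewrite !mxE rmorphM /= conjCK /F conjC_nat mulrACA.
rewrite sum_incidence /F (bigD1 r1) //= [X in _ + X]big1 ?addr0; last first.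
  by move=> r rr1; rewrite big1 // => d _; rewrite (negbTE rr1) !mul0r.
by rewrite mulr_sumr; apply: eq_bigr => d _; rewrite eqxx mul1r.
Qed.

Lemma frame_coisometry n : W n *m (W n)^t* = K%:R%:M.
Proof.
apply/matrixP => r1 r2; rewrite frame_gram !mxE mulrC mulr_natr; congr (_ *+ _).
rewrite -(card_block r1) -sumr_const; apply: eq_bigr => d _.
by rewrite mulrC -normCK X_norm expr1n.
Qed.

Lemma char_at0 n : X n 0 = 1.
Proof. by rewrite -[0](subrr 0) XB -normCK X_norm expr1n. Qed.

(** The entry at two coordinates of the same block is the sum of all characters at the difference of
    their group elements; across blocks it is 0. *)
Lemma frame_sum : \sum_n (W n)^t* *m W n = #|G|%:R%:M.
Proof.
apply/matrixP => p p'; rewrite summxE !mxE.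
transitivity (((enum_val p).1 == (enum_val p').1)%:R *
   \sum_n X n ((enum_val p).2 - (enum_val p').2)).
  rewrite mulr_sumr; apply: eq_bigr => n _; rewrite !mxE.
  rewrite (bigD1 (enum_val p).1) //= big1 ?addr0; last first.
    by move=> r rp; rewrite !mxE eq_sym (negbTE rp) !(mul0r, mulr0, rmorph0).
  rewrite !mxE eqxx mul1r conjCK XB mulrCA.
  by rewrite [_.1 == _]eq_sym.
have [<-|pp'] := eqVneq p p'.
  rewrite !eqxx mul1r (eq_bigr (fun=> 1)) => [|n _]; last by rewrite subrr char_at0.
  by rewrite sumr_const card_ord.
case: eqP => [e1|_]; last by rewrite mul0r.
rewrite X_col ?mulr0 // subr_eq0; apply: contraNneq pp' => e2.
by rewrite -(inj_eq enum_val_inj) -pair_eqE /= e1 e2 !eqxx.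
Qed.

(** Cyclicity of the trace turns it into a sum of squared moduli of diagonal Gram entries, that is,
    of the character [Y] over all differences within blocks. The difference 0 occurs [K * R] times
    and any other one [L] times, while [Y] sums to -1 over the nonzero elements. *)
Lemma frame_equichordal n1 n2 : n1 != n2 ->
  \tr (((W n1)^t* *m W n1) *m ((W n2)^t* *m W n2)) = (K * R)%:R - L%:R.
Proof.
move=> n12; rewrite -mulmxA mxtrace_mulC.
rewrite (mulmxA (W n1)) -(mulmxA _ _ (_ ^t*)).
pose Y v := X n1 v * (X n2 v)^*.
transitivity (\sum_r \sum_(p in setX (B r) (B r)) Y (p.1 - p.2)).
  apply: eq_bigr => r _; rewrite mxE (bigD1 r) //= big1 ?addr0; last first.
    by move=> r' r'r; rewrite frame_gram eq_sym (negbTE r'r) !mul0r.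
  rewrite !frame_gram eqxx !mul1r mulrC mulr_suml.
  rewrite (eq_bigr _ (fun d _ => mulr_sumr _ _ _ _)) pair_big /=.
  apply: eq_big => [p|p _]; first by rewrite inE.
  rewrite /Y !XB rmorphM /= conjCK.
  by rewrite [RHS]mulrACA; congr (_ * _); rewrite mulrC.
transitivity (\sum_v (\sum_r #|[set d in setX (B r) (B r) | (d.1 - d.2)%R == v]|)%:R * Y v).
  under [RHS]eq_bigr => v _ do rewrite natr_sum mulr_suml.
  rewrite exchange_big; apply: eq_bigr => r _.
  rewrite (partition_big (fun p : G * G => p.1 - p.2) xpredT) //=.
  apply: eq_bigr => v _; rewrite mulr_natl -sumr_const.
  by apply: eq_big => [p|p /andP[_ /eqP ->]//]; rewrite inE.
rewrite (bigD1 0) //= (eq_bigr (fun v => L%:R * Y v)) => [|v v0]; last first.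
  case: DD_DF => _ _ /(_ v v0) <-; congr (_%:R * _).
  by rewrite (big_nth set0) big_mkord.
have -> : (\sum_r #|[set d in setX (B r) (B r) | (d.1 - d.2)%R == 0%R]| = K * R)%N.
  rewrite (eq_bigr (fun=> K)) ?sum_nat_const ?card_ord 1?mulnC // => r _.
  rewrite -(card_block r) -(card_imset (B r) (f := fun d => (d, d))) => [|x y []//].
  apply: eq_card => -[x y]; rewrite !inE /= subr_eq0.
  apply/andP/imsetP => [[/andP[xB _] /eqP <-]|[d dB [-> ->]]]; first by exists x.
  by rewrite dB eqxx.
have Y0 : Y 0 = 1 by rewrite /Y !char_at0 rmorph1 mulr1.
have := X_row n12; rewrite (bigD1 0) //= -/(Y 0) Y0 => /eqP.
rewrite addr_eq0 -eqr_oppLR => /eqP sY.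
by rewrite -mulr_sumr -sY mulr1 mulrN1.
Qed.

End Construction.

Lemma ectff_of_difference_family (C : numClosedFieldType) (G : finZmodType)
    (K L : nat) (DD : seq {set G}) :
  (0 < K)%N -> (1 < #|G|)%N -> is_difference_family K L DD ->
  ectff_exists C (K * size DD) #|G| (size DD).
Proof.
move=> K0 G1 DF; have [X [XB Xc Xn Xr]] := finZmod_characters C G.
rewrite /ectff_exists -(card_incidence C DF).
pose W n := \matrix_(r < size DD, p < #|[set p : 'I_(size DD) * G | p.2 \in nth set0 DD p.1]|)
   (((enum_val p).1 == r)%:R * (X n (enum_val p).2)^* : C).
have K0' : 0 < K%:R :> C by rewrite ltr0n.
have PW n := proj_ortho_of_coisometry K0' (frame_coisometry Xn DF n).
exists (fun n => K%:R^-1 *: ((W n)^t* *m W n)); split=> //.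
- by case: DF; case: (DD).
- by move=> n; case: (PW n).
- exists (K%:R^-1 * #|G|%:R); first by rewrite mulr_gt0 ?invr_gt0 // ltr0n ltnW.
  rewrite -scale_scalar_mx -(frame_sum XB Xc Xn DD) scaler_sumr.
  by apply: eq_bigr => n _; case: (PW n).
exists (K%:R^-1 * (K%:R^-1 * ((K * size DD)%:R - L%:R))) => n1 n2 n12.
have [-> _] := PW n1; have [-> _] := PW n2.
rewrite -scalemxAl -scalemxAr !mxtraceZ; congr (_ * (_ * _)).
exact: frame_equichordal n12.
Qed.

(** * Multiplier orbits *)

Definition diffs (G : finZmodType) (B : {set G}) (v : G) : nat :=
  #|[set d in setX B B | (d.1 - d.2)%R == v]|.

Arguments diffs {G} B v%_R.

(** Lambda is left free, since the frame parameters depend only on the block size and the number of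
    blocks. *)
Definition has_difference_family (G : finZmodType) (K n : nat) : Prop :=
  exists (L : nat) (DD : seq {set G}), size DD = n /\ is_difference_family K L DD.

Section DifferenceFamilies.
Variable G : finZmodType.
Implicit Types (B : {set G}) (v : G) (K L n : nat).

Lemma diffsE B v : diffs B v = (\sum_(x in B) \sum_(y in B) (x - y == v)%R)%N.
Proof.
rewrite pair_big /= /diffs -sum1_card big_mkcond [RHS]big_mkcond /=.
apply: eq_bigr => -[x y] _; rewrite !inE /=.
by case: (x \in B); case: (y \in B); case: (_ == _).
Qed.

Lemma diffsN B v : diffs B (- v) = diffs B v.
Proof.
rewrite !diffsE exchange_big; apply: eq_bigr => x _; apply: eq_bigr => y _.
by rewrite -opprB eqr_opp.
Qed.

Lemma sum_diffs B : (\sum_(v | v != 0%R) diffs B v = #|B| * (#|B| - 1))%N.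
Proof.
under eq_bigr => v _ do rewrite diffsE.
rewrite exchange_big /= -sum_nat_const; apply: eq_bigr => x xB.
rewrite exchange_big (bigD1 x) //= subrr big1 ?add0n => [|v v0]; last first.
  by rewrite eq_sym (negbTE v0).
rewrite (eq_bigr (fun=> 1%N)) => [|y /andP[_ yx]]; last first.
  rewrite (bigD1 (x - y)) ?subr_eq0 1?eq_sym //= eqxx big1 ?addn0 // => v.
  by case/andP=> _ vxy; rewrite eq_sym (negbTE vxy).
rewrite sum1_card (cardsD1 x B) xB addKn.
by apply: eq_card => y; rewrite !inE andbC.
Qed.

(** Both sides count the ordered pairs of distinct elements within blocks. *)
Lemma difference_family_size K L (DD : seq {set G}) :
  is_difference_family K L DD -> (size DD * (K * (K - 1)) = L * (#|G| - 1))%N.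
Proof.
case=> _ cardB sumL.
transitivity (\sum_(v | v != 0%R) \sum_(B <- DD) diffs B v)%N.
  rewrite exchange_big /= big_seq (eq_bigr (fun=> K * (K - 1)))%N => [|B BD].
    by rewrite -big_seq big_const_seq count_predT iter_addn_0 mulnC.
  by rewrite sum_diffs cardB.
rewrite (eq_bigr (fun=> L)) ?sum_nat_const => [|v v0]; last exact: sumL.
rewrite mulnC; congr (_ * _)%N; rewrite -[#|G|]cardsT (cardsD1 0) inE addKn.
by apply: eq_card => v; rewrite !inE andbT.
Qed.

Lemma has_difference_familyD K n1 n2 : has_difference_family G K n1 ->
  has_difference_family G K n2 -> has_difference_family G K (n1 + n2).
Proof.
move=> [L1 [D1 [s1 [ne1 c1 e1]]]] [L2 [D2 [s2 [_ c2 e2]]]].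
exists (L1 + L2)%N, (D1 ++ D2); split; first by rewrite size_cat s1 s2.
split; first by case: (D1) ne1.
  by move=> B; rewrite mem_cat => /orP[/c1|/c2].
by move=> v v0; rewrite big_cat /= e1 ?e2.
Qed.

Lemma has_difference_family_dvd K n R : (0 < R)%N -> (n %| R)%N ->
  has_difference_family G K n -> has_difference_family G K R.
Proof.
move=> R0 /dvdnP[c Rc] dfn; move: R0; rewrite {}Rc; case: c => // c _.
elim: c => [|c IHc]; first by rewrite mul1n.
by rewrite mulSn; apply: has_difference_familyD.
Qed.

Lemma has_difference_family_gt0 K n : has_difference_family G K n -> (0 < n)%N.
Proof. by case=> L [DD [<- []]]; case: DD. Qed.

(** This settles the case K = Q, where repeating the block reaches every R. *)
Lemma has_difference_family_setT : has_difference_family G #|G| 1.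
Proof.
exists #|G|, [:: [set: G]]; split=> //; split=> //.
  by move=> B; rewrite inE => /eqP ->; rewrite cardsT.
move=> v _; rewrite big_seq1 -/(diffs _ v) diffsE -[RHS]sum1_card.
apply: eq_big => [x|x _]; first by rewrite inE.
rewrite (eq_bigl xpredT) => [|y]; last by rewrite inE.
rewrite (bigD1 (x - v)) //= subKr eqxx big1 ?addn0 // => y yx.
by apply/eqP; rewrite eqb0; apply: contra yx => /eqP <-; rewrite subKr.
Qed.

End DifferenceFamilies.

Lemma sum_periodic (u : nat -> nat) (p h : nat) :
  (forall i, u (i + p)%N = u i) ->
  (\sum_(i < h * p) u i = h * \sum_(i < p) u i)%N.
Proof.
move=> up; elim: h => [|h IHh]; first by rewrite !mul0n big_ord0.
rewrite mulSn addnC big_split_ord /= IHh [RHS]mulSn addnC; congr addn.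
apply: eq_bigr => i _; rewrite addnC.
by elim: h {IHh} => [|h IHh]; rewrite ?addn0 // mulSn addnCA addnC up.
Qed.

Section Multipliers.
Variable F : finFieldType.
Implicit Types (B : {set F}) (v z : F) (K p h : nat).

Lemma diffs_div B v z : z != 0 -> diffs [set x / z | x in B] v = diffs B (v * z).
Proof.
move=> z0; have injz : injective (fun x => x / z) by apply: mulIf; rewrite invr_eq0.
rewrite !diffsE big_imset /=; last by move=> x y _ _ /injz.
apply: eq_bigr => x _; rewrite big_imset /=; last by move=> y y' _ _ /injz.
apply: eq_bigr => y _; congr nat_of_bool; rewrite -mulrBl.
by apply/eqP/eqP => [<-|->]; rewrite ?divfK ?mulfK.
Qed.

Lemma diffs_mul_invariant B z v : z != 0 -> (forall x, (x * z \in B) = (x \in B)) ->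
  diffs B (v * z) = diffs B v.
Proof.
move=> z0 Bz; rewrite -diffs_div //; congr diffs; apply/setP => x.
apply/imsetP/idP => [[y yB ->]|xB]; first by rewrite -Bz divfK.
by exists (x * z); rewrite ?Bz ?mulfK.
Qed.

(* The orbit of [B] under a cyclic group of multipliers is a difference family
   as soon as its total difference count is constant; a stabiliser of order [h]
   of the difference function then makes every [p]-th block redundant. *)
Lemma difference_family_orbit B K z p h c : (0 < p)%N -> (0 < h)%N -> z != 0 ->
  #|B| = K -> (forall v, diffs B (v * z ^+ p) = diffs B v) ->
  (forall v, v != 0 -> (\sum_(i < h * p) diffs B (v * z ^+ i) = c)%N) ->
  has_difference_family F K p.
Proof.
move=> p0 h0 z0 cardB Bzp sumc.
(* The total [c] consists of [h] equal sums over one period, so the quotient is exact. Dividing the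
   block by [z ^+ i] multiplies the argument of [diffs] by it. *)
exists (c %/ h)%N, [seq [set x / z ^+ i | x in B] | i <- iota 0 p].
rewrite size_map size_iota; split=> //; split.
- by case: (p) p0.
- move=> B' /mapP[i _ ->]; rewrite card_imset //.
  by apply: mulIf; rewrite invr_eq0 expf_neq0.
move=> v v0; rewrite big_map -(sumc v v0).
rewrite (@sum_periodic (fun i => diffs B (v * z ^+ i))) => [|i]; last first.
  by rewrite exprD mulrA Bzp.
rewrite mulKn // -[p in iota 0 p]subn0 -/(index_iota 0 p) big_mkord.
by apply: eq_bigr => i _; rewrite -/(diffs _ v) diffs_div ?expf_neq0.
Qed.

End Multipliers.

(** * Blocks that are unions of cyclotomic cosets *)

Lemma finField_prim_root (F : finFieldType) : exists g : F, #|F|.-1.-primitive_root g.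
Proof.
have F_gt1 := finNzRing_gt1 F.
have : has #|F|.-1.-primitive_root (enum [pred x : F | x != 0]).
  apply: has_prim_root.
  - by rewrite -ltnS prednK // ltnW.
  - apply/allP => x; rewrite mem_enum inE => x0; rewrite unity_rootE.
    by rewrite -(inj_eq (mulfI x0)) mulr1 -exprS prednK ?expf_card // ltnW.
  - exact: enum_uniq.
  rewrite -cardE; have := cardC1 (0 : F) => <-; apply: subset_leq_card.
  by apply/subsetP => x; rewrite !inE.
by case/hasP=> g _ gP; exists g.
Qed.

Lemma sum_ord_lt p t : (t <= p)%N -> (\sum_(i < p) (i < t) = t)%N.
Proof.
move=> tp; rewrite -big_mkcond /= (eq_bigl (fun i : 'I_p => (i < t)%N)) //.
by rewrite (big_ord_narrow tp) sum_nat_const card_ord muln1.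
Qed.

Section Cyclotomy.
Variables (F : finFieldType) (g : F).
Local Notation q1 := #|F|.-1.
Hypothesis g_prim : q1.-primitive_root g.
Implicit Types (B : {set F}) (v z : F) (K p h : nat).

Lemma prim_neq0 : g != 0.
Proof. by rewrite (prim_root_eq0 g_prim) -lt0n (prim_order_gt0 g_prim). Qed.

Lemma prim_log v : v != 0 -> exists i : 'I_q1, v = g ^+ i.
Proof.
move=> v0; case: (prim_rootP g_prim (x := v)) => [|i ->]; last by exists i.
apply: (mulfI v0); rewrite mulr1 -exprS prednK ?expf_card //.
by rewrite ltnW ?finNzRing_gt1.
Qed.

Lemma prim_inj (i j : 'I_q1) : g ^+ i = g ^+ j -> i = j.
Proof.
by move=> /eqP; rewrite (eq_prim_root_expr g_prim) !modn_small // => /eqP/val_inj.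
Qed.

Lemma sum_prim_powers (u : F -> nat) v : v != 0 ->
  (\sum_(i < q1) u (v * g ^+ i)%R = \sum_(w | w != 0%R) u w)%N.
Proof.
move=> v0; rewrite [RHS](eq_bigl (mem [set v * g ^+ (i : 'I_q1) | i in 'I_q1])) => [|w].
  by rewrite big_imset //= => i j _ _ /(mulfI v0)/prim_inj.
apply/idP/imsetP => [w0|[i _ ->]]; last by rewrite mulf_neq0 ?expf_neq0 ?prim_neq0.
have [|i iP] := @prim_log (w / v); first by rewrite mulf_neq0 ?invr_eq0.
by exists i; rewrite // -iP mulrC divfK.
Qed.

(** Under all powers of [g], a nonzero [v] runs through all nonzero elements, so the total count is
    [K * (K - 1)] for any block. *)
Lemma difference_family_invariant B K h p : q1 = (h * p)%N -> #|B| = K ->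
  (forall v, diffs B (v * g ^+ p) = diffs B v) -> has_difference_family F K p.
Proof.
move=> q1E cardB Bp; have := prim_order_gt0 g_prim; rewrite q1E muln_gt0 => /andP[h0 p0].
apply: (difference_family_orbit (c := (K * (K - 1))%N) p0 h0 prim_neq0 cardB Bp) => v v0.
by rewrite -q1E (sum_prim_powers (diffs B)) // sum_diffs cardB.
Qed.

Lemma difference_family_closed B K h p : q1 = (h * p)%N -> #|B| = K ->
  (forall x, (x * g ^+ p \in B) = (x \in B)) -> has_difference_family F K p.
Proof.
move=> q1E cardB Bp; apply: (difference_family_invariant q1E cardB) => v.
by rewrite diffs_mul_invariant ?expf_neq0 ?prim_neq0.
Qed.

Lemma prim_half p : q1 = (p + p)%N -> g ^+ p = -1.
Proof.
move=> q1E; have: (g ^+ p) ^+ 2 == 1.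
  by rewrite -exprM muln2 -addnn -q1E (prim_expr_order g_prim).
rewrite -[X in _ == X](expr1n _ 2) eqf_sqr => /orP[/eqP gp1|/eqP//].
have := prim_order_dvd g_prim p; rewrite gp1 eqxx q1E => /dvdn_leq.
have := prim_order_gt0 g_prim; rewrite q1E; lia.
Qed.

(** Since -1 = g^(hp) and [h] is odd, -g^p = g^((h+1)p) is a power of g^(2p) and stabilises [B].
    Difference counts are even functions, so g^p preserves them even if it moves the block, and half
    the orbit is enough. *)
Lemma difference_family_closed_half B K h p : q1 = (h * (2 * p))%N -> odd h ->
  #|B| = K -> (forall x, (x * g ^+ (2 * p) \in B) = (x \in B)) ->
  has_difference_family F K p.
Proof.
move=> q1E odd_h cardB Bp.
apply: (@difference_family_invariant B K (2 * h) p); rewrite ?q1E //; first by lia.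
move=> v; rewrite -diffsN -mulrN.
have -> : - g ^+ p = (g ^+ (2 * p)) ^+ (h.+1./2).
  rewrite -mulN1r -(@prim_half (h * p)); last by rewrite q1E; lia.
  have hE : (2 * h.+1./2 = h.+1)%N.
    by rewrite -[h.+1./2]/(uphalf h) uphalf_half odd_h; have := odd_double_half h; lia.
  by rewrite -exprD -exprM mulnAC hE mulSnr.
rewrite diffs_mul_invariant ?expf_neq0 ?prim_neq0 //.
by elim: (h.+1./2) => [|n IHn] x; rewrite ?expr0 ?mulr1 // exprSr mulrA Bp IHn.
Qed.

(** The powers of [g] whose exponents have residue below [t] modulo [p] form [t] cosets of the
    subgroup of order [h] generated by [g ^+ p]. *)
Lemma exists_closed_set h p t : q1 = (h * p)%N -> (t <= p)%N ->
  exists B, [/\ #|B| = (h * t)%N, 0 \notin B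
    & forall x, (x * g ^+ p \in B) = (x \in B)].
Proof.
move=> q1E tp; pose B := [set g ^+ (i : 'I_q1) | i in [pred i : 'I_q1 | i %% p < t]%N].
have memB j : (g ^+ j \in B) = (j %% p < t)%N.
  apply/imsetP/idP => [[i it]|jt].
    move=> /eqP; rewrite (eq_prim_root_expr g_prim) => /eqP ij.
    have pq1 : (p %| q1)%N by rewrite q1E dvdn_mull.
    by rewrite -(modn_dvdm j pq1) ij modn_dvdm.
  have jq : (j %% q1 < q1)%N by rewrite ltn_mod (prim_order_gt0 g_prim).
  exists (Ordinal jq); last by rewrite /= (prim_expr_mod g_prim).
  by rewrite inE /= modn_dvdm // q1E dvdn_mull.
have B0 : 0 \notin B.
  by apply/imsetP => -[i _] /esym/eqP; rewrite (negbTE (expf_neq0 _ prim_neq0)).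
exists B; split=> // [|x].
  rewrite card_in_imset => [|i j _ _ /prim_inj //].
  rewrite -sum1_card big_mkcond /=.
  transitivity (\sum_(i < h * p) (i %% p < t))%N.
    by rewrite -q1E; apply: eq_bigr => i _; rewrite inE; case: ltnP.
  rewrite (@sum_periodic (fun i => (i %% p < t)%N : nat)) => [|i]; last by rewrite modnDr.
  congr muln; rewrite -[RHS](sum_ord_lt tp); apply: eq_bigr => i _.
  by rewrite modn_small.
have [->|x0] := eqVneq x 0; first by rewrite mul0r.
by have [i ->] := prim_log x0; rewrite -exprD !memB modnDr.
Qed.

Lemma exists_closed_block (b : bool) u h p : q1 = (h * p)%N -> (h %| u)%N ->
  (u <= q1)%N ->
  exists B, #|B| = (b + u)%N /\ forall x, (x * g ^+ p \in B) = (x \in B).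
Proof.
move=> q1E /dvdnP[t ->] uq.
have h0 : (0 < h)%N by have := prim_order_gt0 g_prim; rewrite q1E muln_gt0 => /andP[].
have [|B [cardB B0 Bp]] := @exists_closed_set h p t q1E.
  by rewrite -(leq_pmul2l h0) -q1E mulnC.
case: b; last by exists B; rewrite cardB mulnC.
exists (0 |: B); split=> [|x]; first by rewrite cardsU1 B0 cardB mulnC.
by rewrite !inE Bp mulf_eq0 (negbTE (expf_neq0 _ prim_neq0)) orbF.
Qed.

(* Here [u * w] is [K * (K - 1)] for the block size [K = b + u]: the flag [b]
   tells whether [0] is put into the block. *)
Lemma difference_family_half_multiple (b : bool) u w R : (0 < R)%N -> (u <= q1)%N ->
  odd (u + w) -> (q1 %| 2 * R * u)%N -> (q1 %| R * u * w)%N ->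
  has_difference_family F (b + u) R.
Proof.
move=> R0 uq odd_uw dvd2 dvdw; have q0 := prim_order_gt0 g_prim.
pose h := gcdn u q1; have h0 : (0 < h)%N by rewrite gcdn_gt0 q0 orbT.
pose p := (q1 %/ h)%N; have q1E : q1 = (h * p)%N by rewrite mulnC divnK ?dvdn_gcdr.
pose u' := (u %/ h)%N; have uE : u = (h * u')%N by rewrite mulnC divnK ?dvdn_gcdl.
have cop : coprime p u'.
  rewrite /coprime -(eqn_pmul2l h0) muln_gcdr -q1E -uE muln1 gcdnC; exact: eqxx.
have p2R : (p %| 2 * R)%N.
  by rewrite -(Gauss_dvdl _ cop) -(dvdn_pmul2l h0) -q1E mulnCA -uE.
have pwR : (p %| R * w)%N.
  by rewrite -(Gauss_dvdl _ cop) -(dvdn_pmul2l h0) -q1E mulnCA -uE mulnAC.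
have [B [cardB Bp]] := exists_closed_block b q1E (dvdn_gcdl _ _) uq.
(* If [p] divides [R], the orbit of [p] blocks is repeated. Otherwise [p] is even and [h] odd, and
   p/2 blocks suffice. *)
have [pR|pNR] := boolP (p %| R)%N.
  exact: has_difference_family_dvd R0 pR (difference_family_closed q1E cardB Bp).
have p_even : ~~ odd p.
  by apply: contra pNR => op; rewrite -(@Gauss_dvdr _ 2) // coprimen2.
have [p' pE] : exists p', p = (2 * p')%N.
  by exists p./2; rewrite mul2n -[LHS]odd_double_half (negbTE p_even).
have h_odd : odd h.
  (* An even [h] makes [u] even and [w] odd, so [p] divides gcd(2R, Rw) = R. *)
  apply: contraNT pNR => h_even.
  have w_odd : odd w by move: odd_uw; rewrite uE oddD oddM (negbTE h_even).
  have := conj p2R pwR => /andP; rewrite -dvdn_gcd [(2 * _)%N]mulnC -muln_gcdr.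
  by rewrite (eqP (_ : coprime 2 w)) ?muln1 // coprime2n.
rewrite pE in q1E Bp; apply: (has_difference_family_dvd R0 _
  (difference_family_closed_half q1E h_odd cardB Bp)).
by rewrite -(@dvdn_pmul2l 2) // -pE.
Qed.

End Cyclotomy.

(** * Blocks with prescribed difference classes *)

Lemma sum_prim_root_eq (F : fieldType) n (z w : F) : n.-primitive_root z ->
  (\sum_(i < n) (w == z ^+ i)%R = (w ^+ n == 1)%R)%N.
Proof.
move=> zP; have [wn1|wn1] := eqVneq (w ^+ n) 1.
  have [j wE] := prim_rootP zP wn1.
  rewrite (bigD1 j) //= wE eqxx big1 // => i ij; apply/eqP; rewrite eqb0.
  by rewrite (eq_prim_root_expr zP) !modn_small // eq_sym.
rewrite big1 // => i _; apply/eqP; rewrite eqb0; apply: contra wn1 => /eqP ->.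
by rewrite exprAC (prim_expr_order zP) expr1n.
Qed.

(** The labels C(j,2) + i number the pairs i < j consecutively from 0, so they meet all residues
    modulo a divisor of C(K,2) equally often. *)
Lemma sum_strict_pairs (u : nat -> nat) K :
  (\sum_(j < K) \sum_(i < j) u ('C(j, 2) + i) = \sum_(t < 'C(K, 2)) u t)%N.
Proof.
elim: K => [|K IHK]; first by rewrite !big_ord0.
by rewrite big_ord_recr IHK binS bin1 big_split_ord.
Qed.

Lemma sum_symmetric_pairs (phi : nat -> nat -> nat) K :
  (forall i j, i < K -> j < K -> phi i j = phi j i)%N ->
  (forall i, i < K -> phi i i = 0)%N ->
  (\sum_(i < K) \sum_(j < K) phi i j = 2 * \sum_(j < K) \sum_(i < j) phi i j)%N.
Proof.
elim: K => [|K IHK] sym diag; first by rewrite !big_ord0.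
rewrite big_ord_recr /= [in RHS]big_ord_recr /= mulnDr -IHK; first last.
- by move=> i iK; apply: diag; apply: ltnW.
- by move=> i j iK jK; apply: sym; apply: ltnW.
under eq_bigr => i _ do rewrite big_ord_recr /=.
rewrite big_split /= -addnA; congr addn; rewrite big_ord_recr /= diag // addn0.
rewrite mul2n -addnn; congr addn; apply: eq_bigr => i _.
by apply: sym; rewrite // ltnS ltnW.
Qed.

Section PowerClasses.
Variables (F : finFieldType) (g : F) (m f : nat).
Local Notation q1 := #|F|.-1.
Hypothesis g_prim : q1.-primitive_root g.
Hypothesis q1E : q1 = (m * f)%N.
Implicit Types (X : {set F}) (x y w : F) (t : nat).

(** The coset of g^t modulo the subgroup generated by g^m consists of the [x] with x^f = e^t, so
    membership becomes an equation between powers. *)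
Let e := g ^+ f.

Lemma power_classes_gt0 : (0 < m)%N /\ (0 < f)%N.
Proof. by apply/andP; rewrite -muln_gt0 -q1E (prim_order_gt0 g_prim). Qed.

Lemma card_field_classes : #|F| = (m * f).+1.
Proof. by rewrite -q1E prednK // ltnW ?finNzRing_gt1. Qed.

Lemma class_prim : m.-primitive_root e.
Proof.
have [m0 f0] := power_classes_gt0.
have := dvdn_prim_root g_prim (_ : m %| q1)%N; rewrite q1E mulKn //.
by apply; rewrite dvdn_mulr.
Qed.

Lemma sum_class x : (\sum_(t < m) (x ^+ f == e ^+ t)%R = (x != 0%R))%N.
Proof.
rewrite (sum_prim_root_eq _ class_prim) -exprM mulnC -q1E.
have [->|x0] := eqVneq x 0.
  by rewrite expr0n eqn0Ngt (prim_order_gt0 g_prim) eq_sym oner_eq0.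
have [i ->] := prim_log g_prim x0.
by rewrite exprAC (prim_expr_order g_prim) expr1n eqxx.
Qed.

Definition neighbours X t x := [set y in X | (y - x) ^+ f == e ^+ t].

Lemma card_neighbours X t x :
  #|neighbours X t x| = (\sum_(y in X) ((y - x) ^+ f == e ^+ t)%R)%N.
Proof.
rewrite -sum1_card big_mkcond [RHS]big_mkcond; apply: eq_bigr => y _.
by rewrite inE; case: (y \in X); case: (_ == _).
Qed.

Lemma sum_neighbours X :
  (\sum_(t < m) \sum_x #|neighbours X t x| = #|X| * (m * f))%N.
Proof.
under eq_bigr => t _ do under eq_bigr => x _ do rewrite card_neighbours.
rewrite exchange_big /=; under eq_bigr => x _ do rewrite exchange_big /=.
rewrite exchange_big /= -sum_nat_const; apply: eq_bigr => y _.
under eq_bigr => x _ do rewrite sum_class subr_eq0.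
rewrite (eq_bigr (fun x => if x != y then 1 else 0)%N) => [|x _]; last first.
  by rewrite eq_sym; case: eqP.
by rewrite -big_mkcond sum1_card cardC1 card_field_classes.
Qed.

(** For such [x] the quotient (y - x)/(y' - x) is an [f]-th root of unity. It equals 1 + (y -
    y')/(y' - x), hence differs from 1 and determines [x]. *)
Lemma card_class_collisions y y' : y != y' ->
  (\sum_x ((y != x) && ((y - x) ^+ f == (y' - x) ^+ f)) <= f - 1)%N.
Proof.
have [m0 f0] := power_classes_gt0; move=> yy'.
pose T := [set x | (y != x) && ((y - x) ^+ f == (y' - x) ^+ f)].
have -> : (\sum_x ((y != x) && ((y - x) ^+ f == (y' - x) ^+ f)) = #|T|)%N.
  rewrite -sum1_card [RHS]big_mkcond; apply: eq_bigr => x _.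
  by rewrite inE; case: (_ && _).
have TP x : x \in T -> y' - x != 0 /\ ((y - x) / (y' - x)) ^+ f = 1.
  rewrite inE => /andP[yx /eqP pw].
  have y'x : y' - x != 0.
    apply/eqP => y'x0; move: pw; rewrite y'x0 expr0n eqn0Ngt f0 => /eqP.
    by rewrite expf_eq0 f0 subr_eq0 (negbTE yx).
  by split=> //; rewrite expr_div_n pw divff // expf_neq0.
pose phi x := (y - x) / (y' - x).
have phiE x : y' - x != 0 -> phi x = 1 + (y - y') / (y' - x).
  by move=> nz; rewrite /phi -[y - x](subrKA y') [X in X / _]addrC mulrDl divff.
suff: (size (1%R :: [seq phi x | x in T]) <= f)%N.
  by rewrite /= size_map -cardE leq_subRL // add1n.
apply: max_unity_roots => //.
  rewrite /= unity_rootE expr1n eqxx; apply/allP => _ /imageP[x /TP[_ xf] ->].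
  by rewrite unity_rootE xf.
rewrite /= map_inj_in_uniq ?enum_uniq ?andbT => [|x1 x2].
  apply/imageP => -[x /TP[nz _] /esym/eqP]; rewrite phiE // -subr_eq0 addrAC subrr add0r.
  by rewrite mulf_eq0 invr_eq0 (negbTE nz) subr_eq0 (negbTE yy').
rewrite !mem_enum => /TP[nz1 _] /TP[nz2 _]; rewrite !phiE // => /addrI.
have yy'0 : y - y' != 0 by rewrite subr_eq0.
by move=> /(mulfI yy'0)/invr_inj/addrI/oppr_inj.
Qed.

(** The left side counts the triples (x, y, y') with y - x and y' - x in the same class: [m * f]
    choices of [x] when y = y', at most [f - 1] otherwise. *)
Lemma sum_neighbours_sqr X :
  (\sum_(t < m) \sum_x #|neighbours X t x| ^ 2
    <= #|X| * (m * f + (#|X| - 1) * (f - 1)))%N.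
Proof.
rewrite (eq_bigr (fun t : 'I_m => \sum_x \sum_(y in X) \sum_(y' in X)
    ((y - x) ^+ f == e ^+ t)%R * ((y' - x) ^+ f == e ^+ t)%R)%N) => [|t _]; last first.
  apply: eq_bigr => x _; rewrite card_neighbours expnS expn1 big_distrl.
  by apply: eq_bigr => y _; rewrite big_distrr.
rewrite exchange_big /=; under eq_bigr => x _ do rewrite exchange_big /=.
rewrite exchange_big /= -sum_nat_const; apply: leq_sum => y yX.
under eq_bigr => x _ do rewrite exchange_big /=.
rewrite exchange_big /=.
have col y' : (\sum_x \sum_(t < m) ((y - x) ^+ f == e ^+ t)%R * ((y' - x) ^+ f == e ^+ t)%R
    = \sum_x ((y != x) && ((y - x) ^+ f == (y' - x) ^+ f)))%N.
  apply: eq_bigr => x _; rewrite -subr_eq0 andbC -mulnb -sum_class big_distrr /=.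
  apply: eq_bigr => t _; rewrite mulnC !mulnb; congr nat_of_bool.
  have [->|_] := eqVneq ((y - x) ^+ f) (e ^+ t); last by rewrite !andbF.
  by rewrite !andbT eq_sym.
rewrite (bigD1 y) //= col leq_add //.
  rewrite (eq_bigr (fun x => if x != y then 1 else 0)%N) => [|x _].
    by rewrite -big_mkcond sum1_card cardC1 card_field_classes.
  by rewrite eqxx andbT eq_sym; case: eqP.
apply: leq_trans (_ : \sum_(y' in X | y' != y) (f - 1) <= _)%N.
  by apply: leq_sum => y' /andP[_ yy']; rewrite col card_class_collisions // eq_sym.
rewrite sum_nat_const leq_mul2r (cardsD1 y X) yX addKn; apply/orP; right.
by apply: subset_leq_card; apply/subsetP => z; rewrite !inE andbC.
Qed.

(** Expand the square: the first moment is known exactly from [sum_neighbours], the second is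
    bounded by [sum_neighbours_sqr]. *)
Lemma neighbours_variance X :
  (\sum_(t < m) \sum_x (m%:R * #|neighbours X t x|%:R - #|X|%:R) ^+ 2
    <= m%:R ^+ 2 * #|X|%:R * #|F|%:R :> rat).
Proof.
have [m0 f0] := power_classes_gt0.
pose N : rat := #|X|%:R.
have S1 : \sum_(t < m) \sum_x #|neighbours X t x|%:R = N * (m%:R * f%:R).
  rewrite -!natrM -sum_neighbours natr_sum; apply: eq_bigr => t _.
  by rewrite natr_sum.
have S2 : \sum_(t < m) \sum_x #|neighbours X t x|%:R ^+ 2
    <= N * (m%:R * f%:R + (N - 1) * (f%:R - 1)).
  have [X0|X0] := posnP #|X|.
    rewrite /N X0 mul0r big1 // => t _; rewrite big1 // => x _.
    move/eqP: X0; rewrite cards_eq0 => /eqP ->.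
    by rewrite (_ : neighbours _ _ _ = set0) ?cards0 ?expr0n //; apply/setP => y; rewrite !inE.
  rewrite /N -(natrB _ X0) -(natrB _ f0) -!natrM -natrD -natrM.
  apply: le_trans (_ : (\sum_(t < m) \sum_x #|neighbours X t x| ^ 2)%N%:R <= _); last first.
    by rewrite ler_nat sum_neighbours_sqr.
  rewrite natr_sum ler_sum // => t _; rewrite natr_sum ler_sum // => x _.
  by rewrite natrX.
have -> : \sum_(t < m) \sum_x (m%:R * #|neighbours X t x|%:R - N) ^+ 2 =
    m%:R ^+ 2 * (\sum_(t < m) \sum_x #|neighbours X t x|%:R ^+ 2)
    - 2 * m%:R * N * (\sum_(t < m) \sum_x #|neighbours X t x|%:R)
    + m%:R * #|F|%:R * N ^+ 2.
  transitivity (\sum_(t < m) \sum_(x : F) (m%:R ^+ 2 * #|neighbours X t x|%:R ^+ 2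
     - 2 * m%:R * N * #|neighbours X t x|%:R + N ^+ 2)).
    by apply: eq_bigr => t _; apply: eq_bigr => x _; ring.
  under eq_bigr => t _ do rewrite big_split /= sumrB -!mulr_sumr sumr_const.
  rewrite big_split /= sumrB -!mulr_sumr sumr_const card_ord.
  congr (_ + _); rewrite -mulrnA -(mulr_natl N) natrM expr2 mulrCA.
  by congr (_ * _); apply: mulrC.
have qE : #|F|%:R = m%:R * f%:R + 1 :> rat by rewrite card_field_classes -natr1 natrM.
rewrite S1 qE -/N.
have mN : 1 <= m%:R :> rat by rewrite ler1n.
have fN : 1 <= f%:R :> rat by rewrite ler1n.
have N0 : 0 <= N by rewrite ler0n.
have m2 : 0 <= m%:R ^+ 2 :> rat by rewrite exprn_ge0 ?ler0n.
apply: le_trans (_ : m%:R ^+ 2 * (N * (m%:R * f%:R + (N - 1) * (f%:R - 1)))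
   - 2 * m%:R * N * (N * (m%:R * f%:R)) + m%:R * (m%:R * f%:R + 1) * N ^+ 2 <= _).
  by rewrite lerD2r lerD2r ler_wpM2l.
rewrite -subr_ge0.
have -> : m%:R ^+ 2 * N * (m%:R * f%:R + 1) -
   (m%:R ^+ 2 * (N * (m%:R * f%:R + (N - 1) * (f%:R - 1))) -
   2 * m%:R * N * (N * (m%:R * f%:R)) + m%:R * (m%:R * f%:R + 1) * N ^+ 2)
   = m%:R ^+ 2 * N * f%:R + N ^+ 2 * m%:R * (m%:R - 1) :> rat by ring.
by rewrite addr_ge0 // !mulr_ge0 ?ler0n ?sqr_ge0 // subr_ge0.
Qed.

(** This is Chebyshev's inequality: each sparse [x] contributes more than a quarter of the square of
    [#|X|] to the variance. *)
Lemma card_sparse_vertices X t :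
  (#|[set x | 2 * m * #|neighbours X t x| < #|X|]%N| * #|X| <= 4 * m ^ 2 * #|F|)%N.
Proof.
have [m0 f0] := power_classes_gt0.
(* Since [e] has order [m], the index [t] can be reduced to one of those summed over in the
   variance. *)
set bad := [set x | _]; have [X0|X0] := posnP #|X|; first by rewrite X0 muln0.
pose t' := Ordinal (ltn_pmod t m0).
have nE x : neighbours X t x = neighbours X t' x.
  by apply/setP => y; rewrite !inE /= (prim_expr_mod class_prim).
rewrite -(leq_pmul2r X0) -(ler_nat rat) !natrM.
apply: le_trans (_ : 4 * (\sum_(t < m) \sum_x
      (m%:R * #|neighbours X t x|%:R - #|X|%:R) ^+ 2) <= _).
  rewrite (bigD1 t') //= [\sum_x _](bigID (mem bad)) /=.
  set S := \sum_(x in bad) _; set S' := \sum_(x | _) _; set S'' := \sum_(i | _) _.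
  have S'0 : 0 <= S' by apply: sumr_ge0 => x _; apply: sqr_ge0.
  have S''0 : 0 <= S'' by apply: sumr_ge0 => i _; apply: sumr_ge0 => x _; apply: sqr_ge0.
  suff: #|bad|%:R * #|X|%:R * #|X|%:R <= 4 * S by lra.
  rewrite -mulrA mulr_natl -sumr_const mulr_sumr; apply: ler_sum => x.
  rewrite inE nE -(ltr_nat rat) !natrM -mulrA.
  have : 0 <= m%:R * #|neighbours X t' x|%:R :> rat by rewrite mulr_ge0 ?ler0n.
  move: (m%:R * _) => a a0; move: (#|X|%:R : rat) => N; nra.
have := neighbours_variance X; rewrite expr2; lra.
Qed.

(** Here [V j] holds the remaining candidates for [b j]. Fixing the first term replaces each later
    set by its neighbours in the prescribed class, which shrinks the lower bound [M] on 2m times the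
    set sizes by a factor 2m. *)
Lemma greedy_sequence r (M : rat) (c : nat -> nat -> nat) (V : nat -> {set F}) :
  0 <= M -> (forall j, (j < r)%N -> M <= (2 * m * #|V j|)%:R) ->
  #|F|%:R * (2 * m)%:R ^+ (2 * r) < M ^+ 2 ->
  exists b : nat -> F, (forall j, (j < r)%N -> b j \in V j) /\
    forall i j, (i < j < r)%N -> (b j - b i) ^+ f = e ^+ c i j.
Proof.
have [m0 f0] := power_classes_gt0.
elim: r M c V => [|r IHr] M c V M0 MV condM.
  by exists (fun=> 0); split=> // i j; rewrite ltn0 andbF.
have m2 : 0 < (2 * m)%:R :> rat by rewrite ltr0n muln_gt0.
have [x xV x_dense] : exists2 x, x \in V 0%N & forall j, (j < r)%N ->
    (#|V j.+1| <= 2 * m * #|neighbours (V j.+1) (c 0 j.+1) x|)%N.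
  pose bad j := [set x | 2 * m * #|neighbours (V j.+1) (c 0%N j.+1) x| < #|V j.+1|]%N.
  have [/existsP[x /andP[xV /forallP xP]]|no_x] :=
      boolP [exists x, (x \in V 0%N) && [forall j : 'I_r, x \notin bad j]].
    by exists x => // j jr; have := xP (Ordinal jr); rewrite inE -leqNgt.
  have covered : (#|V 0%N| <= \sum_(j < r) #|bad j|)%N.
    rewrite -sum1_card.
    apply: leq_trans (_ : \sum_(x in V 0%N) \sum_(j < r) (x \in bad j) <= _)%N.
      apply: leq_sum => x xV; move/existsPn/(_ x): no_x; rewrite xV /=.
      by case/forallPn => j; rewrite negbK => xj; rewrite (bigD1 j) //= xj.
    rewrite exchange_big; apply: leq_sum => j _.
    rewrite -sum1_card big_mkcond [leqRHS]big_mkcond; apply: leq_sum => x _.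
    by case: (x \in V 0%N); case: (x \in bad j).
  (* If each candidate were sparse for some later set, the bounds on sparse points would give M^2 <=
     r (2m)^4 #|F|, and r (2m)^2 <= (2m)^(2r). *)
  have : M ^+ 2 <= #|F|%:R * (2 * m)%:R ^+ (2 * r.+1).
    apply: le_trans (_ : M * (2 * m * #|V 0%N|)%:R <= _).
      by rewrite expr2 ler_wpM2l // MV.
    apply: le_trans (_ : (2 * m)%:R * \sum_(j < r) M * #|bad j|%:R <= _).
      rewrite natrM mulrCA -mulr_sumr -natr_sum.
      by rewrite ler_wpM2l ?ler0n // ler_wpM2l // ler_nat.
    apply: le_trans (_ : (2 * m)%:R * \sum_(j < r) ((2 * m) * (4 * m ^ 2 * #|F|))%:R <= _).
      rewrite ler_wpM2l ?ler0n // ler_sum // => j _.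
      apply: le_trans (_ : (2 * m * #|V j.+1|)%:R * #|bad j|%:R <= _).
        by rewrite ler_wpM2r ?ler0n // MV // ltnS ltn_ord.
      rewrite -natrM ler_nat -mulnA leq_mul2l [(#|V _| * _)%N]mulnC.
      by rewrite card_sparse_vertices orbT.
    rewrite sumr_const card_ord -mulrnA -natrX -!natrM ler_nat.
    have step : (r * (2 * m) ^ 2 <= ((2 * m) ^ 2) ^ r)%N.
      case: (r) => [|s]; first by rewrite mul0n.
      rewrite [leqRHS]expnSr leq_mul2r; apply/orP; right.
      by apply: ltn_expl; rewrite expnS expn1; nia.
    rewrite expnM (expnSr (_ ^ 2)) [leqRHS]mulnA.
    have -> : (2 * m * (2 * m * (4 * m ^ 2 * #|F|) * r) =
               #|F| * (r * (2 * m) ^ 2) * (2 * m) ^ 2)%N.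
      by move: #|F| => q; rewrite !expnS !expn0; lia.
    by rewrite leq_mul2r leq_mul2l step !orbT.
  by rewrite leNgt condM.
pose V' j := neighbours (V j.+1) (c 0%N j.+1) x.
have [|j jr||b [bV bc]] := IHr (M / (2 * m)%:R) (fun i j => c i.+1 j.+1) V'.
- by rewrite divr_ge0 ?ler0n.
- rewrite ler_pdivrMr //; apply: le_trans (MV j.+1 _) _ => //.
  by rewrite -natrM ler_nat mulnC leq_mul2r x_dense ?orbT.
- by rewrite expr_div_n ltr_pdivlMr ?exprn_gt0 // -mulrA -exprD -mulnSr.
exists (fun i => if i is i'.+1 then b i' else x); split=> [[|j] jr|[|i] [|j] //].
- exact: xV.
- by have := bV j jr; rewrite inE => /andP[].
- by rewrite ltnS => jr; have := bV j jr; rewrite inE => /andP[_ /eqP].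
- by rewrite !ltnS => /bc.
Qed.

Lemma card_class t : (f <= #|[set y : F | y ^+ f == e ^+ t]|)%N.
Proof.
have [m0 f0] := power_classes_gt0.
have bound (i : 'I_f) : (m * i < q1)%N by rewrite q1E ltn_pmul2l.
have inj : injective (fun i : 'I_f => g ^+ t * g ^+ (m * i)).
  move=> i j /(mulfI (expf_neq0 _ (prim_neq0 g_prim))).
  move=> /(prim_inj g_prim (i := Ordinal (bound i)) (j := Ordinal (bound j)))/(congr1 val)/=.
  by move/eqP; rewrite eqn_pmul2l // => /eqP/val_inj.
rewrite -[leqLHS]card_ord -(card_imset _ inj); apply: subset_leq_card.
apply/subsetP => _ /imsetP[i _ ->]; rewrite inE exprMn -!exprM mulnAC -q1E.
by rewrite [X in _ * X]exprM (prim_expr_order g_prim) expr1n mulr1 mulnC.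
Qed.

End PowerClasses.

Section SpreadBlocks.
Variables (F : finFieldType) (g : F) (m f : nat).
Local Notation q1 := #|F|.-1.
Hypothesis g_prim : q1.-primitive_root g.
Hypothesis q1E : q1 = (m * f)%N.

(** The first term is normalised to 0, which confines [b j] to the class of index C(j,2). These
    classes have at least [f] elements and start the greedy choice of the other K - 1 terms. *)
Lemma spread_sequence K : (#|F| * (2 * m) ^ (2 * K.-1) < (2 * m * f) ^ 2)%N ->
  exists b : nat -> F,
    forall i j, (i < j < K)%N -> (b j - b i) ^+ f = (g ^+ f) ^+ ('C(j, 2) + i).
Proof.
move=> cond.
have [|j _||b [bV bc]] := greedy_sequence g_prim q1E
  (fun i j => 'C(j.+1, 2) + i.+1)%N (r := K.-1) (M := (2 * m * f)%:R)
  (V := fun j => [set y | y ^+ f == (g ^+ f) ^+ 'C(j.+1, 2)]).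
- exact: ler0n.
- by rewrite ler_nat leq_mul2l (card_class g_prim q1E) orbT.
- by rewrite -!natrX -natrM ltr_nat.
exists (fun i => if i is i'.+1 then b i' else 0) => -[|i] [|j] //.
  move=> jK; rewrite subr0 addn0; apply/eqP.
  have := bV j; rewrite inE; apply; lia.
by move=> ijK; apply: bc; lia.
Qed.

(** The multipliers are the powers of g^m, so the total count at [v] is the number of ordered pairs
    whose difference lies in the class of [v]. As (-1)^f = 1, the order of a pair does not affect
    the class, and equidistribution gives 2 C(K,2)/m. The symmetry [stab], by 1 or -1 in the
    applications, leaves [p] blocks. *)
Lemma difference_family_spread K (b : nat -> F) h p :
  f = (h * p)%N -> (m %| 'C(K, 2))%N -> (-1) ^+ f = 1 :> F ->
  (forall B v, diffs B (v * g ^+ (m * p)) = diffs B v) ->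
  (forall i j, (i < j < K)%N -> (b j - b i) ^+ f = (g ^+ f) ^+ ('C(j, 2) + i)) ->
  has_difference_family F K p.
Proof.
move=> fE m_dvd N1f stab bP; have [m0 f0] := power_classes_gt0 g_prim q1E.
have g0 := prim_neq0 g_prim.
have /andP[h0 p0] : (0 < h)%N && (0 < p)%N by rewrite -muln_gt0 -fE.
have zP : f.-primitive_root (g ^+ m).
  have := dvdn_prim_root g_prim (_ : f %| q1)%N; rewrite q1E mulnK //.
  by apply; rewrite dvdn_mull.
have b_lt_neq i j : (i < j < K)%N -> b i != b j.
  move=> ijK; apply/eqP => bij; have := bP i j ijK; rewrite bij subrr expr0n eqn0Ngt f0.
  by move/esym/eqP; rewrite (negbTE (expf_neq0 _ (expf_neq0 _ g0))).
have b_inj : injective (fun i : 'I_K => b i).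
  move=> i j /eqP bij; apply: val_inj => /=; have := ltn_ord i; have := ltn_ord j.
  case: (ltngtP i j) => // ij jK iK; move: bij.
    by rewrite (negbTE (b_lt_neq i j _)) // ij.
  by rewrite eq_sym (negbTE (b_lt_neq j i _)) // ij.
pose B := [set b (i : 'I_K) | i in 'I_K].
apply: (@difference_family_orbit F B K (g ^+ m) p h (2 * ('C(K, 2) %/ m))%N) => //.
- by rewrite expf_neq0.
- by rewrite card_imset // card_ord.
- by move=> v; rewrite -exprM stab.
move=> v v0; rewrite -fE.
under eq_bigr => i _ do rewrite diffsE.
rewrite exchange_big; under eq_bigr => x _ do rewrite exchange_big.
(* Exactly one power of g^m with exponent below [f] carries [v] to [b i - b j] if their [f]-th
   powers agree, and none otherwise. *)
pose phi i j : nat := (b i - b j) ^+ f == v ^+ f.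
transitivity (\sum_(i < K) \sum_(j < K) phi i j)%N.
  rewrite big_imset /=; last by move=> i j _ _ /b_inj.
  apply: eq_bigr => i _; rewrite big_imset /=; last by move=> j j' _ _ /b_inj.
  apply: eq_bigr => j _; rewrite (eq_bigr (fun k : 'I_f =>
    ((b i - b j) / v == (g ^+ m) ^+ k) : nat)).
    rewrite (sum_prim_root_eq _ zP) expr_div_n; congr nat_of_bool.
    by apply/eqP/eqP => [|->]; rewrite ?divff ?expf_neq0 // => /divr1_eq.
  move=> k _; congr nat_of_bool; apply/eqP/eqP => [->|<-].
    by rewrite mulrC mulKf.
  by rewrite mulrC divfK.
rewrite (@sum_symmetric_pairs phi); last first.
- move=> i _; rewrite /phi subrr expr0n eqn0Ngt f0 /= eq_sym.
  by rewrite (negbTE (expf_neq0 _ v0)).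
- by move=> i j _ _; rewrite /phi -opprB exprNn N1f mul1r.
congr muln.
transitivity (\sum_(j < K) \sum_(i < j) (v ^+ f == (g ^+ f) ^+ ('C(j, 2) + i))%R)%N.
  apply: eq_bigr => j _; apply: eq_bigr => i _.
  by rewrite /phi -opprB exprNn N1f mul1r bP ?ltn_ord //= eq_sym.
rewrite (sum_strict_pairs (fun t => (v ^+ f == (g ^+ f) ^+ t) : nat)).
have /dvdnP[s ->] := m_dvd; rewrite mulnK //.
rewrite (@sum_periodic (fun t => (v ^+ f == (g ^+ f) ^+ t) : nat)).
  by rewrite (sum_class g_prim q1E) v0 muln1.
by move=> i; rewrite exprD (prim_expr_order (class_prim g_prim q1E)) mulr1.
Qed.

End SpreadBlocks.

(** With s = K - 2 and P = m^2 (2m)^(2s), the claim reads q P < (q - 1)^2 and follows from P + 2 <=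
    q. For a = C(K,2) >= 3 one has 4^s < a^(2s), hence P + 2 <= a^(2+4s), and 2 + 4s <= K(K-1). *)
Lemma spread_condition q m f K : (3 <= K)%N -> (0 < m)%N -> (m <= 'C(K, 2))%N ->
  ('C(K, 2) ^ (K * (K - 1)) < q)%N -> q.-1 = (m * f)%N ->
  (q * (2 * m) ^ (2 * K.-1) < (2 * m * f) ^ 2)%N.
Proof.
move=> K3 m0; set a := 'C(K, 2) => ma qa qE.
have a3 : (3 <= a)%N by rewrite -[3%N]/'C(3, 2) leq_bin2l.
case: K K3 @a ma qa a3 => [//|[//|[//|k]]] _ a ma qa a3.
pose s := k.+1; pose P := (m ^ 2 * (2 * m) ^ (2 * s))%N.
have P2 : (P + 2 <= q)%N.
  apply: leq_trans (ltnW qa).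
  apply: (@leq_trans (a ^ (2 + 2 * s + 2 * s))); last first.
    by rewrite leq_pexp2l //; [lia | rewrite /s; nia].
  rewrite !expnD; set A := (a ^ 2 * a ^ (2 * s))%N.
  have A2 : (2 <= A)%N.
    rewrite /A -expnD; apply: leq_trans (_ : a ^ 1 <= _)%N; first by rewrite expn1; lia.
    by rewrite leq_pexp2l //; lia.
  have PA : (P <= A * 4 ^ s)%N.
    rewrite /P /A expnMn [(2 ^ _)%N]expnM mulnCA mulnC leq_mul2r; apply/orP; right.
    by rewrite leq_mul // leq_exp2r.
  have lt4 : (4 ^ s < a ^ (2 * s))%N.
    by rewrite expnM ltn_exp2r //; apply: leq_trans (_ : 3 ^ 2 <= _)%N; rewrite ?leq_exp2r.
  apply: leq_trans (_ : A * (4 ^ s).+1 <= _)%N; last by rewrite leq_mul2l lt4 orbT.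
  rewrite mulnS; lia.
rewrite -mulnA -qE /= -/s mulnS expnD.
have -> : (q * ((2 * m) ^ 2 * (2 * m) ^ (2 * s)) = 4 * (q * P))%N.
  by rewrite /P; set T := ((2 * m) ^ (2 * s))%N; rewrite !expnS !expn0; lia.
have -> : ((2 * q.-1) ^ 2 = 4 * (q.-1 * q.-1))%N by rewrite !expnS !expn0; lia.
rewrite ltn_pmul2l //; move: P P2 => P P2; nia.
Qed.

(** * Difference families over a finite field, for each of the conditions *)

Section FiniteFieldFamilies.
Variable F : finFieldType.
Local Notation q1 := #|F|.-1.

Lemma finField_card_gt0 : (0 < q1)%N /\ #|F| = q1.+1.
Proof. by have := finNzRing_gt1 F; case: #|F| => [|[|n]]. Qed.

(** Write q1 = h1 h2 d; then R = t d with t >= h1 h2. Blocks without 0 give families of h2 d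
    members, blocks with 0 give h1 d members, and [t] is a nonnegative combination of h1 and h2. *)
Lemma difference_family_large_multiple K R : (0 < K)%N -> (K <= q1)%N ->
  (q1 <= R)%N -> (q1 %| R * K * (K - 1))%N -> has_difference_family F K R.
Proof.
move=> K0 Kq qR dvdR; have [g gP] := finField_prim_root F.
have [q0 _] := finField_card_gt0.
pose h1 := gcdn K q1; pose h2 := gcdn (K - 1) q1.
have h1_gt0 : (0 < h1)%N by rewrite gcdn_gt0 q0 orbT.
have h2_gt0 : (0 < h2)%N by rewrite gcdn_gt0 q0 orbT.
have cop : coprime h1 h2.
  apply: coprime_dvdl (dvdn_gcdl _ _) _; apply: coprime_dvdr (dvdn_gcdl _ _) _.
  by rewrite -{1}(subnK K0) addn1 coprimeSn.
have dvd12 : (h1 * h2 %| q1)%N by rewrite Gauss_dvd // !dvdn_gcdr.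
pose d := (q1 %/ (h1 * h2))%N; have q1E : q1 = (h1 * h2 * d)%N by rewrite mulnC divnK.
have dvdR12 : (q1 %| R * (h1 * h2))%N.
  have : (q1 %| R * h1 * (K - 1))%N.
    by rewrite mulnAC /h1 muln_gcdr dvdn_gcd mulnAC dvdR dvdn_mull.
  by move=> dvd1; rewrite mulnA /h2 muln_gcdr dvdn_gcd dvd1 dvdn_mull.
have /dvdnP[t RE] : (d %| R)%N.
  by rewrite -(@dvdn_pmul2l (h1 * h2)) ?muln_gt0 ?h1_gt0 // -q1E mulnC.
have t_ge : (h1 * h2 <= t)%N.
  have d0 : (0 < d)%N by move: q0; rewrite q1E muln_gt0 => /andP[].
  by rewrite -(leq_pmul2r d0) -q1E -RE.
(* This is the multiple of [h1] below [h1 * h2] that is congruent to [t] modulo [h2]; being at most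
   [t], it leaves a nonnegative multiple of [h2]. *)
pose x := (chinese h1 h2 0 t %% (h1 * h2))%N.
have x_lt : (x < h1 * h2)%N by rewrite ltn_mod muln_gt0 h1_gt0.
have /dvdnP[b xE] : (h1 %| x)%N.
  by rewrite /dvdn /x modn_dvdm ?dvdn_mulr // chinese_modl // mod0n.
have /dvdnP[a txE] : (h2 %| t - x)%N.
  rewrite -eqn_mod_dvd; last by rewrite (leq_trans (ltnW x_lt)).
  by rewrite /x modn_dvdm ?dvdn_mull // chinese_modr.
have RE' : (R = a * (h2 * d) + b * (h1 * d))%N.
  by rewrite RE !mulnA -mulnDl -xE -txE subnK // (leq_trans (ltnW x_lt)).
have df1 : has_difference_family F K (h2 * d).
  have q1E1 : q1 = (h1 * (h2 * d))%N by rewrite mulnA.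
  have [B [cardB Bp]] := exists_closed_block gP false q1E1 (dvdn_gcdl K q1) Kq.
  exact: (difference_family_closed gP q1E1 cardB Bp).
have df2 : has_difference_family F K (h1 * d).
  have q1E2 : q1 = (h2 * (h1 * d))%N by rewrite mulnCA mulnA.
  have [|B [cardB Bp]] := exists_closed_block gP true q1E2 (dvdn_gcdl (K - 1) q1).
    by rewrite (leq_trans (leq_subr _ _)).
  by apply: (difference_family_closed gP q1E2 _ Bp); rewrite cardB addnC subnK.
have R0 : (0 < R)%N := leq_trans q0 qR.
(* Families are nonempty, so a vanishing coefficient is treated apart. *)
have [a0|a0] := posnP a.
  by apply: has_difference_family_dvd df2 => //; rewrite RE' a0 add0n dvdn_mull.
have [b0|b0] := posnP b.
  by apply: has_difference_family_dvd df1 => //; rewrite RE' b0 addn0 dvdn_mull.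
have pos1 := has_difference_family_gt0 df1; have pos2 := has_difference_family_gt0 df2.
rewrite RE'; apply: has_difference_familyD.
  by apply: has_difference_family_dvd (dvdn_mull _ (dvdnn _)) df1; rewrite muln_gt0 a0.
by apply: has_difference_family_dvd (dvdn_mull _ (dvdnn _)) df2; rewrite muln_gt0 b0.
Qed.

(** Taking [m] as the gcd of C(K,2) with q1 if q1 is odd, and with q1/2 otherwise, ensures (-1)^f =
    1 and that the number of blocks divides [R]. *)
Lemma difference_family_large_field K R : (3 <= K)%N -> (0 < R)%N ->
  (q1 %| R * K * (K - 1))%N -> ('C(K, 2) ^ (K * (K - 1)) < #|F|)%N ->
  has_difference_family F K R.
Proof.
move=> K3 R0 dvdR bigF; have [g gP] := finField_prim_root F.
have [q0 qS] := finField_card_gt0.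
have a0 : (0 < 'C(K, 2))%N by rewrite bin_gt0 ltnW.
have KE : (K * (K - 1) = 2 * 'C(K, 2))%N.
  by rewrite bin2 subn1 mul2n -[LHS]odd_double_half; case: (K) => // n; rewrite oddM /= andNb.
rewrite -mulnA KE in dvdR.
have [q_odd|q_even] := boolP (odd q1).
  pose m := gcdn 'C(K, 2) q1; have m0 : (0 < m)%N by rewrite gcdn_gt0 a0.
  pose f := (q1 %/ m)%N; have q1E : q1 = (m * f)%N by rewrite mulnC divnK ?dvdn_gcdr.
  have N1 : -1 = 1 :> F.
    have : (-1 : F) ^+ q1 = 1.
      have [i ->] : exists i : 'I_q1, -1 = g ^+ i.
        by apply: prim_log; rewrite // oppr_eq0 oner_eq0.
      by rewrite exprAC (prim_expr_order gP) expr1n.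
    by rewrite -signr_odd q_odd expr1.
  have [b bP] : exists b : nat -> F,
      forall i j, (i < j < K)%N -> (b j - b i) ^+ f = (g ^+ f) ^+ ('C(j, 2) + i).
    apply: (spread_sequence gP q1E); apply: spread_condition q1E => //.
    exact: dvdn_leq (dvdn_gcdl _ _).
  apply: has_difference_family_dvd R0 _
    (difference_family_spread gP q1E (h := 1) (p := f) (K := K) _ _ _ _ bP).
  - rewrite -(@dvdn_pmul2l m) // -q1E [(m * R)%N]mulnC muln_gcdr dvdn_gcd.
    rewrite [X in _ && X]dvdn_mull // andbT.
    by rewrite -(@Gauss_dvdr _ 2) ?coprimen2 // mulnCA.
  - by rewrite mul1n.
  - exact: dvdn_gcdl.
  - by rewrite N1 expr1n.
  - by move=> B v; rewrite -q1E (prim_expr_order gP) mulr1.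
(* Now f = 2p and g^(mp) = -1 preserves difference counts, so [p] blocks suffice. *)
pose q2 := q1./2; have q1E2 : q1 = (q2 + q2)%N.
  by rewrite addnn -[LHS]odd_double_half (negbTE q_even).
have q2_gt0 : (0 < q2)%N by lia.
pose m := gcdn 'C(K, 2) q2; have m0 : (0 < m)%N by rewrite gcdn_gt0 a0.
pose p := (q2 %/ m)%N; have q2E : q2 = (m * p)%N by rewrite mulnC divnK ?dvdn_gcdr.
have q1E : q1 = (m * (2 * p))%N by rewrite mulnCA -q2E mul2n -addnn.
have [b bP] : exists b : nat -> F,
    forall i j, (i < j < K)%N ->
      (b j - b i) ^+ (2 * p) = (g ^+ (2 * p)) ^+ ('C(j, 2) + i).
  apply: (spread_sequence gP q1E); apply: spread_condition q1E => //.
  exact: dvdn_leq (dvdn_gcdl _ _).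
apply: has_difference_family_dvd R0 _
    (difference_family_spread gP q1E (h := 2) (p := p) (K := K) _ _ _ _ bP) => //.
- rewrite -(@dvdn_pmul2l m) // -q2E [(m * R)%N]mulnC muln_gcdr dvdn_gcd.
    rewrite [X in _ && X]dvdn_mull // andbT.
  by rewrite -(@dvdn_pmul2l 2) // mulnCA mul2n -addnn -q1E2.
- exact: dvdn_gcdl.
- by rewrite exprM sqrrN !expr1n.
- by move=> B v; rewrite -q2E (prim_half gP q1E2) mulrN1 diffsN.
Qed.

End FiniteFieldFamilies.

(* Each quotient below is exact where it is used: the divisibility of
   L * (V - 1) by K * (K - 1) is part of the first conclusion (it implies that
   K - 1 divides it too), and K * (K - 1) is even. *)
Theorem corollary4p2 (RR : realType) :
  (forall V K L : nat,
     (2 <= K)%N ->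
     difference_family_exists V K L ->
     (K * (K - 1) %| L * (V - 1))%N /\
     ectff_exists (complex RR) ((L * (V - 1)) %/ (K - 1)) V
                  ((L * (V - 1)) %/ (K * (K - 1))))
  /\
  (forall Q K R : nat,
     prime_power Q ->
     (0 < K)%N -> (0 < R)%N -> (K <= Q)%N ->
     (Q - 1 %| R * K * (K - 1))%N ->
     [\/ (Q - 1 %| 2 * R * K)%N \/ (Q - 1 %| 2 * R * (K - 1))%N,
         (Q - 1 <= R)%N
       | (((K * (K - 1)) %/ 2) ^ (K * (K - 1)) < Q)%N] ->
     ectff_exists (complex RR) (K * R) Q R).
Proof.
split=> [V K L K2 [G [DD [<- DF]]]|Q K R].
  have size_DD := difference_family_size DF.
  have KK0 : (0 < K * (K - 1))%N by rewrite muln_gt0 subn_gt0 K2 ltnW.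
  rewrite -size_DD dvdn_mull // mulnK //; split=> //.
  rewrite mulnA mulnK ?subn_gt0 // mulnC.
  apply: (ectff_of_difference_family _ _ _ DF); first exact: ltnW.
  (* The group contains a block with [K >= 2] elements, so it is nontrivial. *)
  case: DF => ne cardDD _; apply: leq_trans K2 _.
  case: DD ne cardDD {size_DD} => // B DD _ /(_ B); rewrite inE eqxx => /(_ isT) <-.
  exact: max_card.
move=> [p [k [p_pr k0 ->]]].
have [F _ <-] := pPrimePowerField p_pr k0; rewrite !(subn1 #|F|).
move=> K0 R0 KF dvdR conds.
suff [L [DD [<- DF]]] : has_difference_family F K R.
  by apply: (ectff_of_difference_family _ K0 _ DF); apply: finNzRing_gt1.
have [q0 qS] := finField_card_gt0 F.
move: KF; rewrite leq_eqVlt => /orP[/eqP ->|].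
  apply: has_difference_family_dvd R0 (dvd1n _) _; exact: has_difference_family_setT.
rewrite qS ltnS => Kq; have [g gP] := finField_prim_root F.
have K1q : (K - 1 <= #|F|.-1)%N by rewrite (leq_trans (leq_subr _ _)).
have fromK : (#|F|.-1 %| 2 * R * K)%N -> has_difference_family F K R.
  move=> dvd2; apply: (difference_family_half_multiple gP false (w := K - 1)) => //.
  by rewrite -{1}(subnK K0) addn1 addSn oddS addnn odd_double.
have fromK1 : (#|F|.-1 %| 2 * R * (K - 1))%N -> has_difference_family F K R.
  move=> dvd2; rewrite -(subnKC K0).
  apply: (difference_family_half_multiple gP true (w := K)) => //.
    by rewrite -{2}(subnK K0) addn1 addnS oddS addnn odd_double.
  by rewrite mulnAC.
case: conds => [[|]|qR|bigF].
- exact: fromK.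
- exact: fromK1.
- exact: difference_family_large_multiple.
(* For K = 1 and K = 2 the number 2R(K-1) is already divisible by Q - 1, which is condition (i); the
   greedy construction takes K >= 3. *)
case: K K0 Kq K1q fromK fromK1 dvdR bigF => [//|[|[|K]]] _ Kq K1q fromK fromK1 dvdR bigF.
- by apply: fromK1; rewrite muln0.
- by apply: fromK1; rewrite muln1 mulnC -[(R * 2)%N]muln1.
apply: difference_family_large_field => //.
by rewrite bin2 -divn2 -subn1.
Qed.
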